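(* Let $\mathcal{E}^1,\dots,\mathcal{E}^L$ be $m$-party quantum state ensembles. Then $$\prod_{l=1}^Lp_{\sf L}(\mathcal{E}^l)=p_{\sf L}\Big(\bigotimes_{l=1}^L\mathcal{E}^l\Big)=p_{\sf G}\Big(\bigotimes_{l=1}^L\mathcal{E}^l\Big)$$ if and only if $p_{\sf L}(\mathcal{E}^l)=p_{\sf G}(\mathcal{E}^l)$ for all $l=1,\dots,L$.
   Context: Each ensemble $\mathcal{E}^l=\{\eta^l_i,\rho^l_i\}_{i=1}^{n_l}$ consists of $m$-party states on $\mathcal{H}=\bigotimes_{k=1}^m\mathbb{C}^{d_k}$ ($m,d_k\ge2$) with nonzero probabilities summing to $1$. With $\mathbb{N}_{\vec n}=\{1,\dots,n_1\}\times\cdots\times\{1,\dots,n_L\}$, $\eta_{\vec c}=\prod_l\eta^l_{c_l}$, $\rho_{\vec c}=\bigotimes_l\rho^l_{c_l}$, the sequence ensemble is $\bigotimes_l\mathcal{E}^l=\{\eta_{\vec c},\rho_{\vec c}\}_{\vec c\in\mathbb{N}_{\vec n}}$ on $\mathcal{H}^{\otimes L}$, an $m$-party system where party $\mathsf{A}_k$ holds the $k$-th factor of every copy. A measurement is LOCC if realizable by local operations and classical communication among $\mathsf{A}_1,\dots,\mathsf{A}_m$. For an ensemble $\{\eta_j,\rho_j\}_j$, $p_{\sf G}$ and $p_{\sf L}$ denote the maximum of $\sum_j\eta_j\operatorname{Tr}(\rho_jM_j)$ over all measurements and over all LOCC measurements $\{M_j\}_j$ respectively. *)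

(* Defs.v *)
From HB Require Import structures.
From mathcomp Require Import all_boot all_order all_algebra.
From mathcomp Require Import complex.
From mathcomp Require Import classical_sets reals.
Set Implicit Arguments. Unset Strict Implicit. Unset Printing Implicit Defensive.
Import Order.TTheory GRing.Theory Num.Theory.
Local Open Scope ring_scope.

(* Operators on the Hilbert space C^T (T a finite orthonormal basis). *)
Definition op (R : realType) (T : finType) := T -> T -> R[i].

Definition op_one (R : realType) (T : finType) : op R T :=
  fun x y => if x == y then 1 else 0.

Definition op_mul (R : realType) (T : finType) (A B : op R T) : op R T :=
  fun x z => \sum_(y : T) A x y * B y z.

Definition op_adj (R : realType) (T : finType) (A : op R T) : op R T :=
  fun x y => (A y x)^*.

Definition op_tr (R : realType) (T : finType) (A : op R T) : R[i] :=
  \sum_(x : T) A x x.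

Definition psd (R : realType) (T : finType) (A : op R T) : Prop :=
  forall v : T -> R[i], 0 <= \sum_(x : T) \sum_(y : T) (v x)^* * A x y * v y.

Definition density (R : realType) (T : finType) (rho : op R T) : Prop :=
  psd rho /\ op_tr rho = 1.

Definition povm (R : realType) (T : finType) (J : finType) (M : J -> op R T)
  : Prop :=
  (forall j, psd (M j)) /\ (forall x y, \sum_(j : J) M j x y = @op_one R T x y).

Unset Implicit Arguments.
Record ensemble (R : realType) (T : finType) := Ensemble {
  e_idx : finType;
  e_eta : e_idx -> R;
  e_rho : e_idx -> op R T }.
Arguments e_idx {R T}.
Arguments e_eta {R T}.
Arguments e_rho {R T}.
Arguments Ensemble {R T}.
Set Implicit Arguments.

Definition valid_ensemble (R : realType) (T : finType) (E : ensemble R T)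
  : Prop :=
  (forall i, 0 < e_eta E i) /\ (\sum_(i : e_idx E) e_eta E i = 1) /\
  (forall i, density (e_rho E i)).

Definition succ (R : realType) (T : finType) (E : ensemble R T)
  (M : e_idx E -> op R T) : R :=
  \sum_(j : e_idx E) e_eta E j * complex.Re (op_tr (op_mul (e_rho E j) (M j))).

(* m parties; party k holds a local space with basis X k; the global basis
   is the product of the local ones. *)
Definition gbasis (m : nat) (X : 'I_m -> finType) : finType :=
  {dffun forall k : 'I_m, X k}.

(* a local operator A of party k, acting as A (x) identity on the others *)
Definition lift (R : realType) (m : nat) (X : 'I_m -> finType) (k : 'I_m)
  (A : op R (X k)) : op R (gbasis X) :=
  fun x y => if [forall k' : 'I_m, (k' != k) ==> (x k' == y k')]
             then A (x k) (y k) else 0.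

(* Finite-round LOCC POVMs with outcome set J, described by protocol trees:
   either the parties stop and output j0, or some party k performs a local
   instrument with Kraus operators A_i (sum_i A_i^* A_i = 1), broadcasts i,
   and the parties continue with an LOCC protocol N^i depending on i.
   The resulting POVM is M_j = sum_i A_i^* N^i_j A_i. *)
Inductive locc (R : realType) (m : nat) (X : 'I_m -> finType) (J : finType)
  : (J -> op R (gbasis X)) -> Prop :=
| locc_stop (j0 : J) :
    locc (fun j => if j == j0 then @op_one R (gbasis X) else (fun _ _ => 0))
| locc_round (k : 'I_m) (n : nat) (A : 'I_n -> op R (X k))
    (N : 'I_n -> J -> op R (gbasis X)) :
    (forall x y, \sum_(i < n) op_mul (op_adj (A i)) (A i) x y = @op_one R (X k) x y) ->
    (forall i, locc (N i)) ->
    locc (fun j x y => \sum_(i < n)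
           op_mul (op_adj (lift (A i))) (op_mul (N i j) (lift (A i))) x y).

Definition pG (R : realType) (T : finType) (E : ensemble R T) : R :=
  sup [set r | exists M : e_idx E -> op R T, povm M /\ r = @succ R _ E M].

Definition pL (R : realType) (m : nat) (X : 'I_m -> finType)
  (E : ensemble R (gbasis X)) : R :=
  sup [set r | exists M : e_idx E -> op R (gbasis X), locc M /\ r = @succ R _ E M].

Definition loc1 (m : nat) (d : 'I_m -> nat) : 'I_m -> finType :=
  fun k => 'I_(d k).
Definition Hb (m : nat) (d : 'I_m -> nat) : finType := gbasis (loc1 d).

(* H^{(x)L}: party k holds the k-th factor of each of the L copies *)
Definition locL (m : nat) (d : 'I_m -> nat) (L : nat) : 'I_m -> finType :=
  fun k => {ffun 'I_L -> 'I_(d k)}.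
Definition HbL (m : nat) (d : 'I_m -> nat) (L : nat) : finType :=
  gbasis (locL d L).

Definition copy (m : nat) (d : 'I_m -> nat) (L : nat) (l : 'I_L)
  (x : HbL d L) : Hb d :=
  [ffun k => (x k : {ffun 'I_L -> 'I_(d k)}) l].

Definition seq_ens (R : realType) (m : nat) (d : 'I_m -> nat) (L : nat)
  (E : 'I_L -> ensemble R (Hb d)) : ensemble R (HbL d L) :=
  @Ensemble R (HbL d L) {dffun forall l : 'I_L, e_idx (E l)}
    (fun c => \prod_(l < L) e_eta (E l) (c l))
    (fun c x y => \prod_(l < L) e_rho (E l) (c l) (copy l x) (copy l y)).

(* Main.v *)
(* The value [pG] of discriminating an ensemble equals the least trace of an
   operator dominating all weighted states [eta_j rho_j].  Weak duality is the
   positivity of [tr (A B)] for positive [A] and [B].  Conversely, if a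
   measurement [M] is optimal up to [e^2], then the Hermitian part [K] of
   [\sum_j eta_j rho_j M_j] dominates every [eta_k rho_k] up to [e]: otherwise,
   for [v] with [<v, K v> < <v, eta_k rho_k v>], replacing [M_j] by
   [(1 - t v v^* ) M_j (1 - t v v^* )] and giving the missing weight to outcome
   [k] would improve [M] too much.  Tensor products of dominating operators are
   dominating, so [pG] is multiplicative, while running optimal protocols
   copy by copy shows that [pL] is supermultiplicative.  The theorem follows
   from [0 < pL <= pG]. *)
Require Import Defs.
From HB Require Import structures.
From mathcomp Require Import all_boot all_order all_algebra.
From mathcomp Require Import complex.
From mathcomp Require Import classical_sets reals.
From mathcomp Require Import sesquilinear spectral ring boolp.
Set Implicit Arguments. Unset Strict Implicit. Unset Printing Implicit Defensive.
Import Order.TTheory GRing.Theory Num.Theory.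
Local Open Scope ring_scope.
Local Open Scope sesquilinear_scope.

(** * Positive semidefinite matrices and perturbed measurements *)

Section PsdMatrix.
Variable C : numClosedFieldType.
Implicit Types n p : nat.

Definition qform n (A : 'M[C]_n) (u : 'cV[C]_n) : C := (u^t* *m A *m u) 0 0.

(** In [C] the relation [0 <= z] also says that [z] is real, so hermitian symmetry is a consequence
    ([psdmx_adj]) and not a separate clause. *)
Definition psdmx n (A : 'M[C]_n) := forall u, 0 <= qform A u.

Lemma adjmxM n p q (A : 'M[C]_(n, p)) (B : 'M[C]_(p, q)) :
  (A *m B)^t* = B^t* *m A^t*.
Proof. by rewrite trmx_mul map_mxM. Qed.

Lemma adjmxD n p (A B : 'M[C]_(n, p)) : (A + B)^t* = A^t* + B^t*.
Proof. by rewrite linearD map_mxD. Qed.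

Lemma adjmxB n p (A B : 'M[C]_(n, p)) : (A - B)^t* = A^t* - B^t*.
Proof. by rewrite linearB map_mxB. Qed.

Lemma adjmxZ n p a (A : 'M[C]_(n, p)) : (a *: A)^t* = a^* *: A^t*.
Proof. by rewrite linearZ /= map_mxZ. Qed.

Lemma qformD n (A B : 'M[C]_n) u : qform (A + B) u = qform A u + qform B u.
Proof. by rewrite /qform mulmxDr mulmxDl mxE. Qed.

Lemma qformB n (A B : 'M[C]_n) u : qform (A - B) u = qform A u - qform B u.
Proof. by rewrite /qform mulmxBr mulmxBl mxE; congr (_ + _); rewrite mxE. Qed.

Lemma qformZ n a (A : 'M[C]_n) u : qform (a *: A) u = a * qform A u.
Proof. by rewrite /qform -scalemxAr -scalemxAl mxE. Qed.

Lemma qform_adj n (A : 'M[C]_n) u : qform (A^t*) u = (qform A u)^*.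
Proof.
have e : u^t* *m A^t* *m u = (u^t* *m A *m u)^t*.
  by rewrite !adjmxM trmxCK mulmxA.
by rewrite /qform e [LHS]mxE; congr (_ ^*); rewrite [LHS]mxE.
Qed.

Lemma qformE n (A : 'M[C]_n) u : qform A u = \tr (A *m (u *m u^t*)).
Proof. by rewrite mulmxA mxtrace_mulC mulmxA trace_mx11. Qed.

Lemma qform1_ge0 n (u : 'cV[C]_n) : 0 <= qform 1%:M u.
Proof.
rewrite /qform mulmx1 mxE sumr_ge0 // => i _; rewrite !mxE mulrC.
exact: mul_conjC_ge0.
Qed.

Lemma qform1_eq0 n (u : 'cV[C]_n) : qform 1%:M u = 0 -> u = 0.
Proof.
rewrite /qform mulmx1 mxE => /eqP; rewrite psumr_eq0; last first.
  by move=> i _; rewrite !mxE mulrC mul_conjC_ge0.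
move/allP => H; apply/matrixP => i j; rewrite ord1 mxE.
have := H i (mem_index_enum _); rewrite !mxE mulrC mul_conjC_eq0 /=.
by move/eqP.
Qed.

Lemma psdmxD n (A B : 'M[C]_n) : psdmx A -> psdmx B -> psdmx (A + B).
Proof. by move=> hA hB u; rewrite qformD addr_ge0. Qed.

Lemma psdmxZ n a (A : 'M[C]_n) : 0 <= a -> psdmx A -> psdmx (a *: A).
Proof. by move=> ha hA u; rewrite qformZ mulr_ge0. Qed.

Lemma psdmx_conj n p (A : 'M[C]_n) (B : 'M[C]_(n, p)) :
  psdmx A -> psdmx (B^t* *m A *m B).
Proof.
move=> hA u; have := hA (B *m u); rewrite /qform adjmxM !mulmxA.
by [].
Qed.

Lemma psdmx_gram n p (B : 'M[C]_(n, p)) : psdmx (B^t* *m B).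
Proof. by rewrite -[X in X *m _]mulmx1; apply: psdmx_conj => u; exact: qform1_ge0. Qed.

(** The form of [A] takes real values, so it coincides with the form of the adjoint; polarization
    then recovers all matrix entries from the quadratic form. *)
Lemma psdmx_adj n (A : 'M[C]_n) : psdmx A -> A^t* = A.
Proof.
move=> hA; set B := A^t*.
have key (u v : 'cV[C]_n) : (u^t* *m A *m v) 0 0 = (u^t* *m B *m v) 0 0 :> C.
  have pol (D : 'M[C]_n) c : qform D (u + c *: v) = qform D u +
      `|c| ^+ 2 * qform D v + (c * (u^t* *m D *m v) 0 0 +
      c^* * (v^t* *m D *m u) 0 0).
    rewrite /qform adjmxD adjmxZ !mulmxDl !mulmxDr -!scalemxAr -!scalemxAl.
    have eD (X Y : 'M[C]_1) : (X + Y) 0 0 = X 0 0 + Y 0 0 by rewrite mxE.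
    have eZ a (X : 'M[C]_1) : (a *: X) 0 0 = a * X 0 0 by rewrite mxE.
    by rewrite normCK !(eD, eZ); ring.
  have real w : qform A w = qform B w.
    by rewrite qform_adj; apply/esym/CrealP/ger0_real/hA.
  (* The coefficients [1] and ['i] yield the sum and the difference of the two cross terms; [half]
     extracts the first of them. *)
  have := pol A 1; have := pol B 1; have := pol A 'i; have := pol B 'i.
  rewrite !real => -> /addrI e1 -> /addrI.
  rewrite conjC1 !mul1r => e2.
  move: e1; rewrite conjCi !mulNr -!mulrBr => /(mulfI (neq0Ci _)) e1.
  have half (a b a' b' : C) : a - b = a' - b' -> a + b = a' + b' -> a = a'.
    move=> e3 e4; apply: (mulIf (x := 2%:R)); first by rewrite pnatr_eq0.
    have -> : a * 2%:R = (a - b) + (a + b) by ring.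
    by rewrite e3 e4; ring.
  by apply: esym; exact: half e1 e2.
apply/matrixP => i j.
have := key (delta_mx i 0) (delta_mx j 0).
rewrite !trmx_delta !map_delta_mx -!rowE -!colE !mxE => ->.
by [].
Qed.

(** By the spectral theorem [A] is unitarily diagonal, and its eigenvalues are values of the form,
    hence nonnegative; [X] is the root of the diagonal part times the unitary. *)
Lemma psdmx_gramP n (A : 'M[C]_n) :
  psdmx A -> exists X : 'M[C]_n, A = X^t* *m X.
Proof.
move=> hA.
have /hermitian_normalmx/orthomx_spectralP : A \is hermsymmx.
  by apply/is_hermitianmxP; rewrite expr0 scale1r (psdmx_adj hA).
set P := spectralmx A; set d := spectral_diag A.
have PU : P \is unitarymx := spectral_unitarymx A.
rewrite invmx_unitary // => AE.
have dge i : 0 <= d 0 i.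
  have := hA (P^t* *m delta_mx i 0).
  rewrite /qform adjmxM trmxCK {1}AE !mulmxA.
  rewrite [_ *m P *m P^t*]mulmxtVK // [_ *m P *m P^t*]mulmxtVK //.
  rewrite trmx_delta map_delta_mx -rowE -colE !mxE eqxx mulr1n.
  by [].
pose s := map_mx sqrtC d.
exists (diag_mx s *m P).
rewrite adjmxM tr_diag_mx map_diag_mx mulmxA -[X in X *m P]mulmxA.
rewrite mulmx_diag {1}AE; congr (_ *m diag_mx _ *m _).
apply/rowP => i; rewrite !mxE.
rewrite /=; have /CrealP -> : sqrtC (d 0 i) \is Num.real by rewrite realE sqrtC_ge0 dge.
by rewrite -expr2 sqrtCK.
Qed.

(** With [B = X^t* *m X], cyclicity turns the trace into a sum of values of the form of [A] at the
    columns of [X^t*]. *)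
Lemma psdmx_trM_ge0 n (A B : 'M[C]_n) : psdmx A -> psdmx B -> 0 <= \tr (A *m B).
Proof.
move=> hA /psdmx_gramP[X ->]; rewrite mulmxA mxtrace_mulC mulmxA.
rewrite /mxtrace sumr_ge0 // => i _.
have := hA (X^t* *m delta_mx i 0); rewrite /qform adjmxM trmxCK.
rewrite trmx_delta map_delta_mx -!mulmxA -rowE !mulmxA -colE !mxE.
by [].
Qed.

Lemma psdmx_rank1 n (v : 'cV[C]_n) : psdmx (v *m v^t*).
Proof. by rewrite -{1}[v]trmxCK; exact: psdmx_gram. Qed.

Definition shrink n (v : 'cV[C]_n) (e : C) : 'M[C]_n :=
  1%:M - e *: (v *m v^t*).

Lemma shrink_adj n (v : 'cV[C]_n) (e : C) : 0 <= e -> (shrink v e)^t* = shrink v e.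
Proof.
move=> e0; rewrite /shrink adjmxB adjmxZ adjmxM trmxCK trmx1 map_mx1.
by congr (_ - _ *: _); exact/CrealP/ger0_real.
Qed.

(** The square of [v *m v^t*] is a multiple of itself, so what the square of [shrink v e] lacks to
    the identity again has rank at most one; [perturb] hands this part to one outcome. *)
Lemma shrink_sqr n (v : 'cV[C]_n) e : shrink v e *m shrink v e =
  1%:M - (e *+ 2 - e ^+ 2 * qform 1%:M v) *: (v *m v^t*).
Proof.
have vv : v *m v^t* *m (v *m v^t*) = qform 1%:M v *: (v *m v^t*).
  rewrite mulmxA -[v *m v^t* *m v]mulmxA [v^t* *m v]mx11_scalar mul_mx_scalar.
  by rewrite -scalemxAl /qform mulmx1.
rewrite /shrink mulmxBl mul1mx mulmxBr mulmx1 -scalemxAl -scalemxAr vv.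
move: (v *m v^t*) => P; apply/matrixP => i j; rewrite !mxE.
by ring.
Qed.

(* At [e = <v,v>^-1] the square of [shrink v e] is [1 - <v,v>^-1 v v^*]. *)
Lemma qform_le_tr n (A : 'M[C]_n) v :
  psdmx A -> qform A v <= \tr A * qform 1%:M v.
Proof.
move=> hA; have [/qform1_eq0 -> | N0] := eqVneq (qform 1%:M v) 0.
  by rewrite /qform !mulmx0 mxE mulr0.
set N := qform 1%:M v in N0 *; pose S := shrink v N^-1.
have N_ge0 : 0 <= N := qform1_ge0 v.
have SE : N *: (S^t* *m S) = N%:M - v *m v^t*.
  rewrite shrink_adj ?invr_ge0 // shrink_sqr -/N scalerBr scalerA.
  have -> : N * (N^-1 *+ 2 - N^-1 ^+ 2 * N) = 1 by field.
  by rewrite scale1r scale_scalar_mx mulr1.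
rewrite -subr_ge0.
have -> : \tr A * N - qform A v = N * \tr (A *m (S^t* *m S)).
  rewrite -mxtraceZ scalemxAr SE mulmxBr mul_mx_scalar raddfB /= mxtraceZ.
  by rewrite -qformE mulrC.
by rewrite mulr_ge0 // psdmx_trM_ge0 //; exact: psdmx_gram.
Qed.

(** * First-order perturbation of a nearly optimal measurement *)

Section Perturbation.
Variables (n : nat) (J : finType) (W : J -> 'M[C]_n).

Definition score (M : J -> 'M[C]_n) : C := \sum_j \tr (W j *m M j).

Definition povmx (M : J -> 'M[C]_n) :=
  (forall j, psdmx (M j)) /\ \sum_j M j = 1%:M.

Hypothesis W_psd : forall j, psdmx (W j).
Hypothesis W_tr1 : forall j, \tr (W j) <= 1.

(** The Lagrange multiplier of the constraint [\sum_j M j = 1%:M], made hermitian by force because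
    [M] need not be exactly optimal. *)
Definition multiplier (M : J -> 'M[C]_n) : 'M[C]_n :=
  2%:R^-1 *: (\sum_j W j *m M j + (\sum_j W j *m M j)^t*).

(** Each [\tr (W j *m M j)] is real, so passing to the hermitian part leaves the trace unchanged. *)
Lemma tr_multiplier M : (forall j, psdmx (M j)) -> \tr (multiplier M) = score M.
Proof.
move=> hM; rewrite mxtraceZ raddfD /=.
have -> : \tr ((\sum_j W j *m M j)^t*) = \tr (\sum_j W j *m M j).
  rewrite trace_map_mx mxtrace_tr; apply/CrealP.
  by rewrite raddf_sum /= ger0_real // sumr_ge0 // => j _; exact: psdmx_trM_ge0.
by rewrite raddf_sum -/(score M); field.
Qed.

(* Measuring [1 - e v v^*] first and spending the freed weight on outcome [k]
   gives again a POVM; its score differs from that of [M] to first order by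
   [2 e <v, (W k - multiplier M) v>]. *)
Definition perturb (M : J -> 'M[C]_n) k (v : 'cV[C]_n) (e : C) (j : J) :=
  shrink v e *m M j *m shrink v e +
  (if j == k then (e *+ 2 - e ^+ 2 * qform 1%:M v) *: (v *m v^t*) else 0).

Lemma perturb_povmx M k v (e : C) : povmx M -> 0 <= e -> e * qform 1%:M v <= 2%:R ->
  povmx (perturb M k v e).
Proof.
move=> [hM M1] e0 e2; split=> [j|].
  apply: psdmxD; first by rewrite -{1}shrink_adj //; exact: psdmx_conj.
  case: eqP => _; last by move=> u; rewrite /qform mulmx0 mul0mx mxE.
  apply: psdmxZ; last exact: psdmx_rank1.
  (* The freed weight is [e * (2 - e * qform 1%:M v)], which the bound on [e] keeps nonnegative. *)
  by rewrite -mulr_natr expr2 -mulrA -mulrBr mulr_ge0 // subr_ge0.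
rewrite big_split /= -mulmx_suml -mulmx_sumr M1 mulmx1.
by rewrite -big_mkcond big_pred1_eq /= shrink_sqr subrK.
Qed.

(** The score is expanded exactly in [e]; the only term dropped is [e ^+ 2 * \sum_j qform (W j) v *
    qform (M j) v], which is nonnegative. *)
Lemma score_perturb_ge M k v (e : C) : (forall j, psdmx (M j)) -> 0 <= e ->
  score M + e *+ 2 * (qform (W k) v - qform (multiplier M) v)
    - e ^+ 2 * qform 1%:M v * qform (W k) v <= score (perturb M k v e).
Proof.
move=> hM e0.
(* The two first-order terms are conjugate to each other, as [W j *m M j] and [M j *m W j] are
   adjoint; their sum is what the hermitian part in [multiplier] produces. *)
have term j : \tr (W j *m (shrink v e *m M j *m shrink v e)) =
    \tr (W j *m M j) - e * (qform (W j *m M j) v + (qform (W j *m M j) v)^*)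
      + e ^+ 2 * (qform (W j) v * qform (M j) v).
  rewrite -qform_adj adjmxM !psdmx_adj //.
  have -> : W j *m (shrink v e *m M j *m shrink v e) =
     W j *m M j - e *: (W j *m M j *m (v *m v^t*))
     - e *: (W j *m (v *m v^t*) *m M j)
     + e ^+ 2 *: (W j *m v *m (v^t* *m M j *m v) *m v^t*).
    rewrite /shrink mulmxBl mul1mx !mulmxBr mulmx1 -!scalemxAl -!scalemxAr.
    rewrite mulmxBl !mulmxBr -!scalemxAl -!scalemxAr scalerBr scalerA -expr2.
    by rewrite !mulmxA opprB addrA addrAC; congr (_ + _); rewrite addrAC.
  rewrite !raddfD /= !raddfN /= !mxtraceZ -qformE.
  have -> : \tr (W j *m (v *m v^t*) *m M j) = qform (M j *m W j) v.
    by rewrite qformE [LHS]mxtrace_mulC !mulmxA.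
  have -> : \tr (W j *m v *m (v^t* *m M j *m v) *m v^t*) =
      qform (W j) v * qform (M j) v.
    rewrite [v^t* *m M j *m v]mx11_scalar -/(qform _ _) mul_mx_scalar.
    by rewrite -scalemxAl mxtraceZ -mulmxA -qformE mulrC.
  by ring.
have lag : qform (multiplier M) v =
    2%:R^-1 * \sum_j (qform (W j *m M j) v + (qform (W j *m M j) v)^*).
  rewrite qformZ qformD qform_adj.
  have -> : qform (\sum_j W j *m M j) v = \sum_j qform (W j *m M j) v.
    by rewrite /qform mulmx_sumr mulmx_suml summxE.
  by rewrite raddf_sum -big_split.
rewrite {2}/score; under eq_bigr => j _ do rewrite mulmxDr raddfD /= term.
rewrite !big_split /= sumrN -mulr_sumr -mulr_sumr.
have -> : \sum_j \tr (W j *m (if j == k then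
      (e *+ 2 - e ^+ 2 * qform 1%:M v) *: (v *m v^t*) else 0)) =
    (e *+ 2 - e ^+ 2 * qform 1%:M v) * qform (W k) v.
  rewrite (bigD1 k) //= eqxx big1 ?addr0; last first.
    by move=> j /negPf ->; rewrite mulmx0 raddf0.
  by rewrite -scalemxAr mxtraceZ -qformE.
rewrite -/(score M) lag; set s := \sum_j (_ + _).
rewrite -subr_ge0.
have -> : score M - e * s + e ^+ 2 * (\sum_j qform (W j) v * qform (M j) v) +
    (e *+ 2 - e ^+ 2 * qform 1%:M v) * qform (W k) v -
    (score M + e *+ 2 * (qform (W k) v - 2%:R^-1 * s) -
      e ^+ 2 * qform 1%:M v * qform (W k) v) =
    e ^+ 2 * (\sum_j qform (W j) v * qform (M j) v) by field.
rewrite mulr_ge0 ?exprn_ge0 // sumr_ge0 // => j _.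
by rewrite mulr_ge0 //; [exact: W_psd | exact: hM].
Qed.

(** Perturbing along [v] with step [e / N], where [N] is the squared norm of [v], may gain at most
    [e ^+ 2]; this scaling makes first order, second order and allowed gain comparable. The
    resulting step times [N] is [e], whence the bound [e <= 2%:R]. *)
Lemma near_optimal_dual M (e : C) : 0 < e -> e <= 2%:R -> povmx M ->
  (forall M', povmx M' -> score M' <= score M + e ^+ 2) ->
  forall k, psdmx (multiplier M + e%:M - W k).
Proof.
move=> e0 e2 hM opt k v; set N := qform 1%:M v.
have N_ge0 : 0 <= N := qform1_ge0 v.
have [/qform1_eq0 -> | N0] := eqVneq N 0; first by rewrite /qform mulmx0 mxE.
have N_gt0 : 0 < N by rewrite lt_def N0.
rewrite qformB qformD -scalemx1 qformZ -/N.
have eN0 : 0 <= e / N by rewrite divr_ge0 // ltW.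
have hp : povmx (perturb M k v (e / N)).
  by apply: perturb_povmx => //; rewrite -/N divfK.
have := le_trans (score_perturb_ge k v hM.1 eN0) (opt _ hp).
rewrite -/N -subr_ge0.
set w := qform (W k) v; set l := qform (multiplier M) v.
(* The trace bound on [W k] enters here: it gives the second-order remainder
   [(e / N) ^+ 2 * N * (N - w)] its sign. *)
have wN : w <= N.
  by apply: le_trans (qform_le_tr _ (W_psd k)) _; rewrite ler_piMl.
have -> : score M + e ^+ 2 - (score M + (e / N) *+ 2 * (w - l)
     - (e / N) ^+ 2 * N * w) =
   e / N *+ 2 * (l + e * N - w) - (e / N) ^+ 2 * N * (N - w).
  by field.
rewrite subr_ge0 => h.
have {h} : 0 <= e / N *+ 2 * (l + e * N - w).
  apply: le_trans h; rewrite mulr_ge0 ?subr_ge0 //.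
  by rewrite mulr_ge0 ?exprn_ge0.
by rewrite pmulr_rge0 // pmulrn_lgt0 // divr_gt0.
Qed.
End Perturbation.

End PsdMatrix.

(** * Duality for state discrimination *)

Section OpMatrix.
Variables (R : realType) (T : finType).
Implicit Types A B : op R T.

Definition opmx A : 'M[R[i]]_#|T| := \matrix_(i, j) A (enum_val i) (enum_val j).

Definition mxop (M : 'M[R[i]]_#|T|) : op R T :=
  fun x y => M (enum_rank x) (enum_rank y).

Lemma opmxK : cancel opmx mxop.
Proof. by move=> A; apply/eq2_fun => x y; rewrite /mxop mxE !enum_rankK. Qed.

Lemma mxopK : cancel mxop opmx.
Proof. by move=> M; apply/matrixP => i j; rewrite mxE /mxop !enum_valK. Qed.

Lemma sum_enum_val (F : T -> R[i]) : \sum_x F x = \sum_(i < #|T|) F (enum_val i).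
Proof. by rewrite (reindex _ (onW_bij _ (@enum_val_bij T))). Qed.

Lemma opmxM A B : opmx (op_mul A B) = opmx A *m opmx B.
Proof.
apply/matrixP => i j; rewrite !mxE /op_mul sum_enum_val.
by apply: eq_bigr => k _; rewrite !mxE.
Qed.

Lemma op_trE A : op_tr A = \tr (opmx A).
Proof.
by rewrite /op_tr /mxtrace sum_enum_val; apply: eq_bigr => k _; rewrite !mxE.
Qed.

Lemma qform_opmx A u :
  qform (opmx A) u = \sum_x \sum_y
    (u (enum_rank x) 0)^* * A x y * u (enum_rank y) 0.
Proof.
rewrite /qform mxE [RHS]exchange_big [RHS]sum_enum_val /=.
apply: eq_bigr => j _; rewrite mxE big_distrl [RHS]sum_enum_val /=.
by apply: eq_bigr => i _; rewrite !mxE !enum_valK.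
Qed.

Lemma psdE A : psd A <-> psdmx (opmx A).
Proof.
split=> [hA u|hA v]; first by rewrite qform_opmx; exact: hA.
have := hA (\col_i v (enum_val i)); rewrite qform_opmx.
under eq_bigr => x _ do under eq_bigr => y _ do rewrite !mxE !enum_rankK.
by [].
Qed.

Lemma opmx1 : opmx (@op_one R T) = 1%:M.
Proof.
apply/matrixP => i j; rewrite !mxE /op_one (inj_eq enum_val_inj).
by case: eqP.
Qed.

Lemma psd_trM_ge0 A B : psd A -> psd B -> 0 <= op_tr (op_mul A B).
Proof. by move=> /psdE hA /psdE hB; rewrite op_trE opmxM psdmx_trM_ge0. Qed.

Lemma psd_gramP A : psd A -> exists w : 'I_#|T| -> T -> R[i],
  forall x y, A x y = \sum_i (w i x)^* * w i y.
Proof.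
move=> /psdE /psdmx_gramP [X XE]; exists (fun i x => X i (enum_rank x)) => x y.
rewrite -[A]opmxK XE /mxop mxE; apply: eq_bigr => i _.
by rewrite !mxE.
Qed.

Lemma psd_gram (I : finType) (w : I -> T -> R[i]) :
  psd (fun x y => \sum_i (w i x)^* * w i y).
Proof.
move=> v.
have -> : \sum_x \sum_y (v x)^* * (\sum_i (w i x)^* * w i y) * v y =
    \sum_i (\sum_x w i x * v x)^* * (\sum_y w i y * v y).
  under eq_bigr => x _ do under eq_bigr => y _ do
    rewrite mulr_sumr mulr_suml.
  under eq_bigr => x _ do rewrite exchange_big.
  rewrite exchange_big /=; apply: eq_bigr => i _.
  rewrite rmorph_sum mulr_suml; apply: eq_bigr => x _.
  rewrite mulr_sumr; apply: eq_bigr => y _.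
  by rewrite rmorphM; ring.
by rewrite sumr_ge0 // => i _; rewrite mulrC mul_conjC_ge0.
Qed.

Lemma psd_sum (I : finType) (F : I -> op R T) :
  (forall i, psd (F i)) -> psd (fun x y => \sum_i F i x y).
Proof.
move=> hF v.
have -> : \sum_x \sum_y (v x)^* * (\sum_i F i x y) * v y =
    \sum_i \sum_x \sum_y (v x)^* * F i x y * v y.
  under eq_bigr => x _ do under eq_bigr => y _ do
    rewrite mulr_sumr mulr_suml.
  under eq_bigr => x _ do rewrite exchange_big.
  by rewrite exchange_big.
by rewrite sumr_ge0 // => i _; exact: hF.
Qed.

Lemma psdD A B : psd A -> psd B -> psd (fun x y => A x y + B x y).
Proof.
move=> hA hB v.
have -> : \sum_x \sum_y (v x)^* * (A x y + B x y) * v y =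
    (\sum_x \sum_y (v x)^* * A x y * v y) + \sum_x \sum_y (v x)^* * B x y * v y.
  rewrite -big_split; apply: eq_bigr => x _; rewrite -big_split.
  by apply: eq_bigr => y _; rewrite mulrDr mulrDl.
exact: addr_ge0.
Qed.

Lemma psdZ (a : R[i]) A : 0 <= a -> psd A -> psd (fun x y => a * A x y).
Proof.
move=> a0 hA v.
have -> : \sum_x \sum_y (v x)^* * (a * A x y) * v y =
    a * (\sum_x \sum_y (v x)^* * A x y * v y).
  rewrite mulr_sumr; apply: eq_bigr => x _; rewrite mulr_sumr.
  by apply: eq_bigr => y _; ring.
exact: mulr_ge0.
Qed.

Lemma psd0 : psd (fun _ _ : T => 0 : R[i]).
Proof.
by move=> v; rewrite big1 // => x _; rewrite big1 // => y _; rewrite mulr0 mul0r.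
Qed.

Lemma psd_one : psd (@op_one R T).
Proof. by apply/psdE; rewrite opmx1 => u; exact: qform1_ge0. Qed.

Lemma opmx_adj A : opmx (op_adj A) = (opmx A)^t*.
Proof. by apply/matrixP => i j; rewrite !mxE. Qed.

Lemma psd_conj A B : psd A -> psd (op_mul (op_adj B) (op_mul A B)).
Proof.
move=> /psdE hA; apply/psdE; rewrite !opmxM opmx_adj mulmxA.
exact: psdmx_conj.
Qed.

Lemma op_mul1 : right_id (@op_one R T) (@op_mul R T).
Proof. by move=> A; apply: (can_inj opmxK); rewrite opmxM opmx1 mulmx1. Qed.

Lemma op_1mul : left_id (@op_one R T) (@op_mul R T).
Proof. by move=> A; apply: (can_inj opmxK); rewrite opmxM opmx1 mul1mx. Qed.

End OpMatrix.

(** * Dominating operators, weak and strong duality *)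

Section Discrimination.
Variables (R : realType) (T : finType) (E : ensemble R T).
Hypothesis vE : valid_ensemble E.

Definition weighted (j : e_idx E) : op R T :=
  fun x y => (e_eta E j)%:C%C * e_rho E j x y.

(** Feasibility in the dual semidefinite program, whose objective is the trace of [K]. *)
Definition dominates (K : op R T) :=
  forall j, psd (fun x y => K x y - weighted j x y).

Lemma ReD (x y : R[i]) : complex.Re (x + y) = complex.Re x + complex.Re y.
Proof. by case: x; case: y. Qed.

Lemma ReM_real (a : R) (x : R[i]) :
  complex.Re (a%:C%C * x) = a * complex.Re x.
Proof. by case: x => u v /=; rewrite mul0r subr0. Qed.

Lemma Re_sum (I : finType) (F : I -> R[i]) :
  complex.Re (\sum_i F i) = \sum_i complex.Re (F i).
Proof. by apply: (big_morph _ ReD). Qed.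

Lemma Re_ge0 (x : R[i]) : 0 <= x -> 0 <= complex.Re x.
Proof. by rewrite lecE => /andP[]. Qed.

Lemma succE M :
  @succ R T E M = complex.Re (\sum_j op_tr (op_mul (weighted j) (M j))).
Proof.
rewrite Re_sum; apply: eq_bigr => j _; rewrite -ReM_real; congr complex.Re.
rewrite mulr_sumr; apply: eq_bigr => x _; rewrite /op_mul mulr_sumr.
by apply: eq_bigr => y _; rewrite mulrA.
Qed.

Lemma psd_weighted j : psd (weighted j).
Proof. by apply: psdZ; [rewrite ler0c ltW // vE.1 | have [] := vE.2.2 j]. Qed.

Lemma tr_weighted j : op_tr (weighted j) = (e_eta E j)%:C%C.
Proof. by rewrite /op_tr -mulr_sumr -/(op_tr _) (vE.2.2 j).2 mulr1. Qed.

Lemma eta_le1 j : e_eta E j <= 1.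
Proof.
rewrite -vE.2.1 (bigD1 j) //= lerDl sumr_ge0 // => i _.
exact/ltW/vE.1.
Qed.

(** Inserting [\sum_j M j = 1] splits the trace of [K] over the outcomes, and the excess at outcome
    [j] is the trace of a product of two positive operators. *)
Lemma weak_duality K M :
  dominates K -> povm M -> @succ R T E M <= complex.Re (op_tr K).
Proof.
move=> hK [M0 M1]; rewrite succE -subr_ge0.
have -> : op_tr K = \sum_j op_tr (op_mul K (M j)).
  rewrite -[K in LHS]op_mul1 /op_tr [RHS]exchange_big /=; apply: eq_bigr => x _.
  rewrite /op_mul [RHS]exchange_big /=; apply: eq_bigr => y _.
  by rewrite -M1 mulr_sumr.
have -> (a b : R[i]) : complex.Re a - complex.Re b = complex.Re (a - b).
  by case: a; case: b.
apply: Re_ge0; rewrite -sumrB sumr_ge0 // => j _.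
have := psd_trM_ge0 (hK j) (M0 j).
suff -> : op_tr (op_mul (fun x y => K x y - weighted j x y) (M j)) =
  op_tr (op_mul K (M j)) - op_tr (op_mul (weighted j) (M j)) by [].
rewrite /op_tr -sumrB; apply: eq_bigr => x _; rewrite /op_mul -sumrB.
by apply: eq_bigr => y _; rewrite mulrBl.
Qed.

(** A crude dual point; through weak duality it bounds all success values, so that the [sup] in [pG]
    is a genuine supremum. *)
Lemma dominates_sum : dominates (fun x y => \sum_j weighted j x y).
Proof.
move=> j.
have -> : (fun x y => \sum_i weighted i x y - weighted j x y) =
    fun x y => \sum_i (if i == j then fun _ _ => 0 else weighted i) x y.
  apply/eq2_fun => x y; rewrite (bigD1 j) //= [RHS](bigD1 j) //= eqxx add0r.
  by rewrite addrAC subrr add0r; apply: eq_bigr => i /negPf ->.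
apply: psd_sum => i; case: eqP => _; [exact: psd0 | exact: psd_weighted].
Qed.

Lemma idx_inhabited : exists j : e_idx E, True.
Proof.
have [j _|noj] := pickP (mem (e_idx E)); first by exists j.
by have := vE.2.1; rewrite big_pred0 // => /esym/eqP; rewrite oner_eq0.
Qed.

Lemma povm_exists : exists M : e_idx E -> op R T, povm M.
Proof.
have [j0 _] := idx_inhabited.
exists (fun j => if j == j0 then @op_one R T else fun _ _ => 0); split=> [j|x y].
  by case: eqP => _; [exact: psd_one | exact: psd0].
by rewrite (bigD1 j0) //= eqxx big1 ?addr0 // => j /negPf ->.
Qed.

Lemma pG_has_sup :
  has_sup [set r | exists M : e_idx E -> op R T, povm M /\ r = @succ R _ E M].
Proof.
split; first by have [M hM] := povm_exists; exists (@succ R _ E M); exists M.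
exists (complex.Re (op_tr (fun x y => \sum_j weighted j x y))) => _ [M [hM ->]].
exact: weak_duality dominates_sum hM.
Qed.

Lemma pG_ub M : povm M -> @succ R _ E M <= pG E.
Proof. by move=> hM; apply: ub_le_sup; [exact: pG_has_sup.2 | exists M]. Qed.

Lemma scoreE M : score (fun j => opmx (weighted j)) (fun j => opmx (M j)) =
  \sum_j op_tr (op_mul (weighted j) (M j)).
Proof. by apply: eq_bigr => j _; rewrite op_trE opmxM. Qed.

Lemma score_real M : povm M ->
  \sum_j op_tr (op_mul (weighted j) (M j)) = (@succ R _ E M)%:C%C.
Proof.
move=> [hM _]; rewrite succE RRe_real // ger0_real // sumr_ge0 // => j _.
exact: psd_trM_ge0 (psd_weighted j) (hM j).
Qed.

Lemma povm_mx (M : e_idx E -> op R T) : povm M <-> povmx (fun j => opmx (M j)).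
Proof.
split=> [] [h0 h1]; split.
- by move=> j; apply/psdE.
- rewrite -opmx1; apply/matrixP => i j; rewrite summxE mxE -h1.
  by apply: eq_bigr => k _; rewrite mxE.
- by move=> j; apply/psdE.
- move=> x y; rewrite -(opmxK (@op_one R T)) opmx1 -h1 /mxop summxE.
  by apply: eq_bigr => k _; rewrite mxE !enum_rankK.
Qed.

(** An approximate dual optimum suffices, so neither side has to be shown attained: a measurement
    within [e1 ^+ 2] of [pG E] supplies the multiplier. *)
Lemma strong_duality (e : R) : 0 < e ->
  exists K : op R T, dominates K /\ complex.Re (op_tr K) < pG E + e.
Proof.
(* Adding [e1] times the identity costs [e1 *+ #|T|] in trace, kept strictly below [e] by the
   denominator [#|T|.+1]; the cap at [1] ensures [e1 <= 2]. *)
move=> e0; pose e1 := Num.min (e / #|T|.+1%:R) 1.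
have e1_gt0 : 0 < e1 by rewrite lt_min ltr01 divr_gt0 // ltr0n.
have [_ [M [hM ->]] hs] := sup_adherent (exprn_gt0 2 e1_gt0) pG_has_sup.
pose W j := opmx (weighted j); pose N j := opmx (M j).
pose K := multiplier W N + (e1%:C%C)%:M.
have WP j : psdmx (W j) by apply/psdE/psd_weighted.
have hN : povmx N by apply/povm_mx.
exists (mxop K); split.
  move=> j; apply/psdE.
  have -> : opmx (fun x y => mxop K x y - weighted j x y) = K - W j.
    by rewrite -[in RHS](mxopK K); apply/matrixP => i k; rewrite !mxE.
  apply: near_optimal_dual => //.
  - by move=> i; rewrite /W -op_trE tr_weighted lecR eta_le1.
  - by rewrite ltcR.
  - rewrite (_ : 2%:R = (2%:R : R)%:C%C); last by rewrite rmorph_nat.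
    by rewrite lecR ge_min [1 <= _]ler1n orbT.
  - move=> M' hM'.
    have {}hM' : povm (fun j => mxop (M' j)).
      by apply/povm_mx; under eq_fun do rewrite mxopK.
    have -> : M' = fun j => opmx (mxop (M' j)).
      by apply/funext => k; rewrite mxopK.
    rewrite /W /N !scoreE !score_real // -rmorphXn -rmorphD lecR.
    by rewrite -lerBlDr (le_trans _ (ltW hs)) // lerD2r pG_ub.
rewrite op_trE mxopK raddfD /= tr_multiplier //; last by case: hN.
rewrite scoreE score_real // mxtrace_scalar ReD -rmorphMn /=.
rewrite ler_ltD ?pG_ub //.
apply: (@le_lt_trans _ _ (e / #|T|.+1%:R *+ #|T|)).
  by rewrite lerMn2r ge_min lexx orbT.
rewrite -mulr_natr -mulrA gtr_pMr // mulrC ltr_pdivrMr ?ltr0n //.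
by rewrite mul1r ltr_nat.
Qed.

End Discrimination.

(** * Tensor products of operators and of protocols *)

(** Distributivity for dependent families: the choices are moved into the single type of tagged
    elements, where the non-dependent law applies with the tag as filter. *)
Lemma sum_dffun_prod (K : comNzRingType) (I : finType) (J : I -> finType)
  (F : forall i, J i -> K) :
  \sum_(c : {dffun forall i, J i}) \prod_i F i (c i) = \prod_i \sum_j F i j.
Proof.
rewrite (reindex _ (onW_bij _ (@dffun_of_fprod_bij _ J))).
pose G i : {ffun J i -> K} := [ffun j => F i j].
under eq_bigr => c _ do under eq_bigr => i _ do
  rewrite ffunE -[F i _](ffunE (F i)) -/(G i).
rewrite (big_fprod _ _ G); apply/esym.
rewrite -[RHS](bigA_distr_big_dep (fun i u => u \in tagged_with J i)
  (fun i u => untag 0 (G i) u)).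
apply: eq_bigr => i _; rewrite -(big_tag (fun i => G i)).
by apply: eq_bigr => j _; rewrite ffunE.
Qed.

(** * Local operators and the measurements of LOCC protocols *)

Section Lift.
Variables (R : realType) (m : nat) (X : 'I_m -> finType).

Lemma op_mul_suml (T I : finType) (F : I -> op R T) (B : op R T) x y :
  \sum_i op_mul (F i) B x y = op_mul (fun x y => \sum_i F i x y) B x y.
Proof.
rewrite exchange_big; apply: eq_bigr => z _.
by rewrite mulr_suml.
Qed.

Lemma op_mul_sumr (T I : finType) (A : op R T) (F : I -> op R T) x y :
  \sum_i op_mul A (F i) x y = op_mul A (fun x y => \sum_i F i x y) x y.
Proof.
rewrite exchange_big; apply: eq_bigr => z _.
by rewrite mulr_sumr.
Qed.

(** An intermediate index contributes only if it agrees with [x] outside party [k], so it is [x]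
    with the [k]-th coordinate replaced, and the sum reduces to one over [X k]. *)
Lemma lift_mul k (A B : op R (X k)) :
  op_mul (Defs.lift A) (Defs.lift B) = Defs.lift (op_mul A B).
Proof.
apply/funeq2P => x z; rewrite /op_mul /Defs.lift.
pose agree (u v : gbasis X) := [forall k', (k' != k) ==> (u k' == v k')].
pose upd (a : X k) : gbasis X := finfun (dfwith x a).
have updk a : upd a k = a by rewrite ffunE dfwith_in.
have updN a k' : k' != k -> upd a k' = x k'.
  by move=> kk; rewrite ffunE dfwith_out // eq_sym.
rewrite (bigID (agree x)) /= addrC big1 ?add0r; last first.
  by move=> y /negPf xy; rewrite -/(agree x y) xy mul0r.
rewrite (reindex_onto upd (fun y : gbasis X => y k)) /=; last first.
  move=> y /forallP xy; apply/ffunP => k'; have [->|kk] := eqVneq k' k.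
    by rewrite updk.
  by rewrite updN //; apply/eqP; have := xy k'; rewrite kk.
rewrite -/(agree x z).
have ua a : agree x (upd a).
  by apply/forallP => k'; apply/implyP => kk; rewrite updN.
have uz a : agree (upd a) z = agree x z.
  by apply: eq_forallb => k'; have [->|kk] := eqVneq k' k; rewrite //= updN.
under eq_bigl => a do rewrite ua updk eqxx.
under eq_bigr => a _ do rewrite -/(agree x (upd a)) -/(agree (upd a) z) ua uz updk.
case: (agree x z) => //.
by rewrite big1 // => a _; rewrite mulr0.
Qed.

Lemma lift_adj k (A : op R (X k)) : op_adj (Defs.lift A) = Defs.lift (op_adj A).
Proof.
apply/funeq2P => x y; rewrite /op_adj /Defs.lift.
have -> : [forall k', (k' != k) ==> (y k' == x k')] =
    [forall k', (k' != k) ==> (x k' == y k')].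
  by apply: eq_forallb => k'; rewrite [y k' == _]eq_sym.
by case: ifP => // _; rewrite conjC0.
Qed.

Lemma lift_one k : Defs.lift (@op_one R (X k)) = @op_one R (gbasis X).
Proof.
apply/funeq2P => x y; rewrite /op_one /Defs.lift.
have [<-|xy] := eqVneq x y.
  by rewrite eqxx; case: ifPn => // /forallPn[k']; rewrite eqxx implybT.
case: ifP => // /forallP h; case: eqP => // xyk; case/eqP: xy.
apply/ffunP => k'; have [->//|kk] := eqVneq k' k.
by have := h k'; rewrite kk => /eqP.
Qed.

Lemma lift_complete k n (A : 'I_n -> op R (X k)) :
  (forall x y, \sum_i op_mul (op_adj (A i)) (A i) x y = @op_one R (X k) x y) ->
  forall x y, \sum_i op_mul (op_adj (Defs.lift (A i))) (Defs.lift (A i)) x y =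
    @op_one R (gbasis X) x y.
Proof.
move=> hA x y; rewrite -(lift_one k).
under eq_bigr => i _ do rewrite lift_adj lift_mul.
rewrite /Defs.lift; case: ifP => _; last by rewrite big1.
exact: hA.
Qed.

(** Induction on the protocol tree: conjugation preserves positivity, and summing over outcomes
    collapses each continuation to the identity, which leaves the completeness relation of the first
    round. *)
Lemma locc_povm (J : finType) (M : J -> op R (gbasis X)) : locc M -> povm M.
Proof.
elim=> [j0|k n A N hA _ IH]; split.
- by move=> j; case: eqP => _; [exact: psd_one | exact: psd0].
- move=> x y; by rewrite (bigD1 j0) //= eqxx big1 ?addr0 // => j /negPf ->.
- by move=> j; apply: psd_sum => i; apply: psd_conj; have [] := IH i.
move=> x y; rewrite exchange_big /= -(lift_complete hA).
apply: eq_bigr => i _; rewrite op_mul_sumr; congr (op_mul _ _ x y).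
apply/funeq2P => u v; rewrite op_mul_suml.
have -> : (fun u v => \sum_j N i j u v) = @op_one R _.
  by apply/funeq2P => u' v'; exact: (IH i).2.
by rewrite op_1mul.
Qed.

End Lift.

(** * Tensor products over the copies *)

Section Tensor.
Variables (R : realType) (m : nat) (d : 'I_m -> nat) (L : nat).
Implicit Types B D : 'I_L -> op R (Hb d).

Definition tens B : op R (HbL d L) :=
  fun x y => \prod_l B l (copy l x) (copy l y).

(** Basis elements are grouped by party; transposing parties and copies identifies them with
    [L]-tuples of basis elements of one copy, where distributivity applies. *)
Lemma sum_prod_copy (F : 'I_L -> Hb d -> R[i]) :
  \sum_(x : HbL d L) \prod_l F l (copy l x) = \prod_l \sum_u F l u.
Proof.
rewrite bigA_distr_bigA /=.
pose f (x : HbL d L) : {ffun 'I_L -> Hb d} := [ffun l => copy l x].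
pose g (h : {ffun 'I_L -> Hb d}) : HbL d L :=
  [ffun k => [ffun l => h l k] : locL d L k].
have fK : cancel f g.
  by move=> x; apply/ffunP => k; apply/ffunP => l; rewrite !ffunE.
have gK : cancel g f.
  by move=> h; apply/ffunP => l; apply/ffunP => k; rewrite !ffunE.
rewrite [RHS](reindex f) /=; last by exists g => ? _; [exact: fK | exact: gK].
by apply: eq_bigr => x _; apply: eq_bigr => l _; rewrite ffunE.
Qed.

Lemma copy_inj (x y : HbL d L) : (forall l, copy l x = copy l y) -> x = y.
Proof.
move=> h; apply/ffunP => k; apply/ffunP => l.
by have /ffunP/(_ k) := h l; rewrite !ffunE.
Qed.

Lemma tens_mul B D : op_mul (tens B) (tens D) = tens (fun l => op_mul (B l) (D l)).
Proof.
apply/funeq2P => x z; rewrite /tens /op_mul.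
rewrite -(sum_prod_copy (fun l u => B l (copy l x) u * D l u (copy l z))).
by apply: eq_bigr => y _; rewrite big_split.
Qed.

Lemma tens_adj B : op_adj (tens B) = tens (fun l => op_adj (B l)).
Proof. by apply/funeq2P => x z; rewrite /op_adj /tens rmorph_prod. Qed.

Lemma tens_one : tens (fun=> @op_one R (Hb d)) = @op_one R (HbL d L).
Proof.
apply/funeq2P => x y; rewrite /tens /op_one.
have [<-|xy] := eqVneq x y; first by rewrite big1 // => l _; rewrite eqxx.
have [l hl] : exists l, copy l x != copy l y.
  apply/existsP; apply: contraNT xy => /existsPn h; apply/eqP/copy_inj => l.
  by apply/eqP; have := h l; rewrite negbK.
by rewrite (bigD1 l) //= (negPf hl) mul0r.
Qed.

Lemma tr_tens B : op_tr (tens B) = \prod_l op_tr (B l).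
Proof. by rewrite /op_tr /tens -(sum_prod_copy (fun l u => B l u u)). Qed.

(** Products of Gram vectors of the factors are Gram vectors of the tensor product. *)
Lemma psd_tens B : (forall l, psd (B l)) -> psd (tens B).
Proof.
move=> hB.
have [w wE] := choice (fun l => psd_gramP (hB l)).
pose u (f : {ffun 'I_L -> 'I_#|Hb d|}) (x : HbL d L) :=
  \prod_l w l (f l) (copy l x).
have -> : tens B = fun x y => \sum_f (u f x)^* * u f y.
  apply/funeq2P => x y; rewrite /tens.
  under eq_bigr => l _ do rewrite wE.
  rewrite bigA_distr_bigA; apply: eq_bigr => f _.
  by rewrite rmorph_prod -big_split.
exact: psd_gram.
Qed.

Definition slot B l (D : op R (Hb d)) : 'I_L -> op R (Hb d) :=
  fun l' => if l' == l then D else B l'.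

Lemma tens_slot B l (D : op R (Hb d)) x y : tens (slot B l D) x y =
  D (copy l x) (copy l y) *
  \prod_(l' | l' != l) B l' (copy l' x) (copy l' y).
Proof.
rewrite /tens (bigD1 l) //= {1}/slot eqxx; congr (_ * _).
by apply: eq_bigr => l' /negPf h; rewrite /slot h.
Qed.

(* Telescoping: pass from [tens B] to [tens D] one factor at a time. *)
Lemma psd_tens_sub B D : (forall l, psd (B l)) ->
  (forall l, psd (fun x y => D l x y - B l x y)) ->
  psd (fun x y => tens D x y - tens B x y).
Proof.
move=> hB hDB.
have hD l : psd (D l).
  have := psdD (hB l) (hDB l).
  by congr psd; apply/funeq2P => x y; rewrite addrC subrK.
pose H (t : nat) := tens (fun l => if (l < t)%N then D l else B l).
have H0 : H 0 = tens B by [].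
have HL : H L = tens D.
  by congr tens; apply/funext => l; rewrite ltn_ord.
(* Consecutive hybrids differ by a tensor product with factor [D l - B l] at [l] and positive
   factors elsewhere. *)
have step (l : 'I_L) : psd (fun x y => H l.+1 x y - H l x y).
  have := @psd_tens (slot (fun l' => if (l' < l)%N then D l' else B l') l
    (fun x y => D l x y - B l x y)).
  rewrite (_ : tens _ = fun x y => H l.+1 x y - H l x y); last first.
    apply/funeq2P => x y; rewrite tens_slot mulrBl.
    congr (_ - _); rewrite /H /tens [RHS](bigD1 l) //=.
      rewrite leqnn; congr (_ * _); apply: eq_bigr => l' ll.
      by rewrite [in RHS]ltnS [in RHS]leq_eqVlt (negPf (ll : (l' : nat) != l)).
    by rewrite ltnn; congr (_ * _).
  apply=> l'; rewrite /slot; case: eqP => [_|_]; first exact: hDB.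
  by case: ifP.
have -> : (fun x y => tens D x y - tens B x y) =
    fun x y => \sum_(l < L) (H l.+1 x y - H l x y).
  apply/funeq2P => x y; rewrite -HL -H0.
  rewrite -(big_mkord predT (fun l => H l.+1 x y - H l x y)).
  by rewrite telescope_sumr.
exact: psd_sum.
Qed.

(** The space of party [k] is itself a product over copies, so [lift] is reused with the copies in
    the role of the parties. *)
Definition local_slot (l : 'I_L) k (A : op R (loc1 d k)) : op R (locL d L k) :=
  @Defs.lift R L (fun=> 'I_(d k)) l A.

Lemma local_slot_complete l k n (A : 'I_n -> op R (loc1 d k)) :
  (forall x y, \sum_i op_mul (op_adj (A i)) (A i) x y = @op_one R _ x y) ->
  forall x y, \sum_i op_mul (op_adj (local_slot l (A i))) (local_slot l (A i)) x y
    = @op_one R _ x y.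
Proof. exact: (@lift_complete R L (fun=> 'I_(d k)) l). Qed.

Lemma lift_local_slot l k (A : op R (loc1 d k)) :
  Defs.lift (local_slot l A) = tens (slot (fun=> @op_one R _) l (Defs.lift A)).
Proof.
apply/funeq2P => x y; rewrite tens_slot.
rewrite /local_slot /Defs.lift /op_one !ffunE.
set P := [forall k', _]; set Q := [forall l', _]; set S := [forall k', _].
have -> : \prod_(l' | l' != l) (if copy l' x == copy l' y then 1 else 0) =
    (if [forall l', (l' != l) ==> (copy l' x == copy l' y)] then 1 else 0) :> R[i].
  case: ifPn => [/forallP h|/forallPn[l']].
    by apply: big1 => l' ll; have := h l'; rewrite ll /= => ->.
  rewrite negb_imply => /andP[ll /negPf h].
  by rewrite (bigD1 l') //= h mul0r.
set T := [forall l', _].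
(* Both conjunctions say that [x] and [y] agree everywhere except possibly at party [k] of copy
   [l]. *)
suff : P && Q = S && T.
  by case: P; case: Q; case: S; case: T => //=; rewrite ?mulr1 ?mulr0 ?mul0r.
have copyE l' z k' : copy l' z k' = (z k' : {ffun 'I_L -> 'I_(d k')}) l'.
  by rewrite ffunE.
apply/andP/andP => [[/forallP hP /forallP hQ]|[/forallP hS /forallP hT]].
  have xy k' : k' != k -> x k' = y k'.
    by move=> kk; apply/eqP; have := hP k'; rewrite kk.
  split; apply/forallP => i; apply/implyP => ii.
    by rewrite !copyE xy.
  apply/eqP/ffunP => k'; rewrite !copyE.
  have [->|kk] := eqVneq k' k; last by rewrite xy.
  by apply/eqP; have := hQ i; rewrite ii.
have xy l' k' : l' != l -> copy l' x k' = copy l' y k'.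
  by move=> ll; have := hT l'; rewrite ll => /eqP ->.
split; apply/forallP => i; apply/implyP => ii; last first.
  by have := xy i k ii; rewrite !copyE => ->.
apply/eqP/ffunP => l'; rewrite -!copyE.
have [->|ll] := eqVneq l' l; last exact: xy.
by apply/eqP; have := hS i; rewrite ii.
Qed.

(** Sequential composition: run [M] on copy [l], then a continuation chosen by its outcome [j].
    Leaves of the tree of [M] are replaced by continuations, and each round becomes a round on copy
    [l] alone. The coefficient [a j c] carries the classical dependence of the final outcome [c] on
    [j]. *)
Lemma locc_slot l (J C : finType) (a : J -> C -> R[i])
    (B : C -> 'I_L -> op R (Hb d)) (M : J -> op R (Hb d)) :
  locc M ->
  (forall j, locc (fun c x y => a j c * tens (slot (B c) l (@op_one R _)) x y)) ->
  locc (fun c x y => \sum_j a j c * tens (slot (B c) l (M j)) x y).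
Proof.
move=> hM hN; elim: hM => [j0|k n A N hA _ IH].
  have -> // : (fun c x y => \sum_j a j c * tens (slot (B c) l
       (if j == j0 then @op_one R _ else fun _ _ => 0)) x y) =
     fun c x y => a j0 c * tens (slot (B c) l (@op_one R _)) x y.
  apply/funext => c; apply/funeq2P => x y.
  rewrite (bigD1 j0) //= eqxx big1 ?addr0 // => j /negPf ->.
  by rewrite tens_slot mul0r mulr0.
have := locc_round (local_slot_complete l hA) IH.
congr locc; apply/funext => c; apply/funeq2P => x y.
rewrite [RHS](_ : _ = \sum_j \sum_i a j c * tens (slot (B c) l
   (op_mul (op_adj (Defs.lift (A i))) (op_mul (N i j) (Defs.lift (A i))))) x y); last first.
  apply: eq_bigr => j _; rewrite tens_slot mulr_suml mulr_sumr.
  by apply: eq_bigr => i _; rewrite tens_slot.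
rewrite [RHS]exchange_big; apply: eq_bigr => i _; rewrite lift_local_slot.
set U := tens (slot _ l (Defs.lift (A i))).
(* Off copy [l] the operator [U] is the identity, so conjugating by it changes only that factor. *)
have tE j : tens (slot (B c) l (op_mul (op_adj (Defs.lift (A i)))
    (op_mul (N i j) (Defs.lift (A i))))) =
    op_mul (op_adj U) (op_mul (tens (slot (B c) l (N i j))) U).
  rewrite /U tens_adj !tens_mul; congr tens; apply/funext => l'.
  rewrite /slot; case: eqP => // _; rewrite op_mul1.
  suff -> : op_adj (@op_one R (Hb d)) = @op_one R _ by rewrite op_1mul.
  apply/funeq2P => u v; rewrite /op_adj /op_one eq_sym.
  by case: eqP; rewrite (conjC0, conjC1).
under [RHS]eq_bigr => j _ do rewrite tE.
have scale (b : R[i]) (D1 D2 D3 : op R (HbL d L)) :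
    b * op_mul D1 (op_mul D2 D3) x y =
    op_mul D1 (op_mul (fun x y => b * D2 x y) D3) x y.
  rewrite /op_mul mulr_sumr; apply: eq_bigr => u _.
  rewrite mulrCA; congr (_ * _); rewrite mulr_sumr.
  by apply: eq_bigr => v _; rewrite mulrA.
under [RHS]eq_bigr => j _ do rewrite scale.
rewrite op_mul_sumr; congr (op_mul _ _ x y); apply/funeq2P => u v.
by rewrite op_mul_suml.
Qed.

(** Induction on the number [n] of copies still to be measured, each step prepending one copy by
    [locc_slot]. The tuple [c0] only initializes the record of outcomes, which is overwritten copy
    by copy. *)
Lemma locc_tens (J : 'I_L -> finType) (M : forall l, J l -> op R (Hb d))
    (c0 : {dffun forall l, J l}) :
  (forall l, locc (M l)) ->
  locc (fun c : {dffun forall l, J l} => tens (fun l => M l (c l))).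
Proof.
move=> hM.
(* The copies below [t] are already measured, with outcomes read off [c0]. *)
pose agree t (c c0 : {dffun forall l, J l}) :=
  [forall l : 'I_L, (l < t)%N ==> (c l == c0 l)].
pose rest t (c : {dffun forall l, J l}) (l : 'I_L) : op R (Hb d) :=
  if (l < t)%N then @op_one R _ else M l (c l).
suff H n : (n <= L)%N -> forall c0, locc (fun c x y =>
    (agree (L - n)%N c c0)%:R * tens (rest (L - n)%N c) x y).
  have := H L (leqnn L) c0; congr locc; apply/funext => c.
  apply/funeq2P => x y; rewrite subnn.
  suff -> : agree 0 c c0 by rewrite mul1r.
  exact/forallP.
elim: n => [_ c1|n IH nL c1].
  have := @locc_stop R m (locL d L) _ c1.
  congr locc; apply/funext => c; rewrite subn0.
  have -> : agree L c c1 = (c == c1).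
    apply/forallP/eqP => [h|-> l]; last by rewrite eqxx implybT.
    by apply/ffunP => l; have := h l; rewrite ltn_ord => /eqP.
  have -> : tens (rest L c) = @op_one R _.
    rewrite -tens_one; congr tens; apply/funext => l.
    by rewrite /rest ltn_ord.
  by apply/funeq2P => x y; case: eqP => _; rewrite ?mul1r ?mul0r.
set t := (L - n.+1)%N.
have tS : (L - n)%N = t.+1 by rewrite /t subnSK.
have tL : (t < L)%N by rewrite -tS leq_subr.
rewrite tS in IH; pose l := Ordinal tL.
pose upd (j : J l) : {dffun forall l, J l} := finfun (dfwith c1 j).
have updl j : upd j l = j by rewrite ffunE dfwith_in.
have updN j l' : l' != l -> upd j l' = c1 l'.
  by move=> ll; rewrite ffunE dfwith_out // eq_sym.
have slotE c (D : op R (Hb d)) : slot (rest t.+1 c) l D = slot (rest t c) l D.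
  apply/funext => l'; rewrite /slot; have [//|ll] := eqVneq l' l.
  by rewrite /rest [in LHS]ltnS [in LHS]leq_eqVlt (negPf (ll : (l' : nat) != t)).
have := @locc_slot l (J l) _ (fun j c => (agree t.+1 c (upd j))%:R) (rest t.+1)
  (M l) (hM l).
rewrite (_ : (fun c x y => \sum_j _) =
  fun c x y => (agree t c c1)%:R * tens (rest t c) x y); last first.
  apply/funext => c; apply/funeq2P => x y.
  (* Compatibility with the updated record forces [j = c l], so a single term of the sum over [j]
     survives. *)
  have agE j : agree t.+1 c (upd j) = (c l == j) && agree t c c1.
    apply/forallP/andP => [h|[/eqP cl /forallP h] l'].
      split; first by have := h l; rewrite updl ltnSn.
      apply/forallP => l'; apply/implyP => lt; have := h l'.
      by rewrite updN ?ltnS ?(ltnW lt) // -(inj_eq val_inj) neq_ltn lt.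
    have [->|ll] := eqVneq l' l; first by rewrite updl cl eqxx implybT.
    have := h l'; rewrite updN // => hl; rewrite ltnS leq_eqVlt.
    by rewrite (negPf (ll : (l' : nat) != t)).
  rewrite (bigD1 (c l)) //= big1 ?addr0 => [|j /negPf jl]; last first.
    by rewrite agE eq_sym jl mul0r.
  rewrite agE eqxx slotE; congr (_ * tens _ x y); apply/funext => l'.
  by rewrite /slot; case: eqP => // ->; rewrite /rest ltnn.
apply=> j; have := IH (ltnW nL) (upd j); congr locc.
apply/funext => c; apply/funeq2P => x y; congr (_ * tens _ x y).
apply/funext => l'; rewrite /slot; case: eqP => // ->.
by rewrite /rest ltnSn.
Qed.

End Tensor.

(** * Sequences of ensembles *)

(* Replace the factors by their bounds one at a time. *)
Lemma prod_closure (R : numDomainType) (L : nat) (S : 'I_L -> set R)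
    (s : 'I_L -> R) (Q : R -> Prop) :
  (forall l r, S l r -> 0 <= r) -> (forall l, 0 <= s l) ->
  (forall l, exists r, S l r) ->
  (forall l c, 0 <= c -> (forall r, S l r -> Q (r * c)) -> Q (s l * c)) ->
  (forall r : 'I_L -> R, (forall l, S l (r l)) -> Q (\prod_l r l)) ->
  Q (\prod_l s l).
Proof.
move=> S0 s0 Sne HQ Hprod.
suff H t : (t <= L)%N -> forall r : 'I_L -> R, (forall l, S l (r l)) ->
    Q (\prod_(l < L) if (l < t)%N then s l else r l).
  have [r hr] := choice Sne; have := H L (leqnn L) r hr.
  by congr Q; apply: eq_bigr => l _; rewrite ltn_ord.
elim: t => [_ r hr|t IH tL r hr]; first exact: Hprod.
pose l := Ordinal tL.
rewrite (bigD1 l) //= ltnSn; apply: HQ => [|a ha].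
  by apply: prodr_ge0 => l' _; case: ifP => // _; exact: S0 (hr l').
have := IH (ltnW tL) (fun l' => if l' == l then a else r l').
rewrite (bigD1 l) //= ltnn eqxx => h.
rewrite (eq_bigr (fun l' : 'I_L => if (l' < t)%N then s l' else
    (if l' == l then a else r l'))); last first.
  move=> l' ll; rewrite [in LHS]ltnS [in LHS]leq_eqVlt.
  by rewrite (negPf (ll : (l' : nat) != t)) (negPf ll).
by apply: h => l'; case: eqP => [->|_].
Qed.

Section Sequence.
Variables (R : realType) (m : nat) (d : 'I_m -> nat) (L : nat).
Variable E : 'I_L -> ensemble R (Hb d).
Hypothesis vE : forall l, valid_ensemble (E l).

Local Notation meas l := (e_idx (E l) -> op R (Hb d)).

Lemma Re_prod_ge0 (z : 'I_L -> R[i]) : (forall l, 0 <= z l) ->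
  complex.Re (\prod_l z l) = \prod_l complex.Re (z l).
Proof.
move=> z0.
have -> : \prod_l z l = (\prod_l complex.Re (z l))%:C%C; last by [].
rewrite rmorph_prod; apply: eq_bigr => l _.
exact/esym/RRe_real/ger0_real.
Qed.

Lemma psd_tr_ge0 (T : finType) (A : op R T) : psd A -> 0 <= op_tr A.
Proof.
by move=> hA; rewrite -[A]op_mul1; apply: psd_trM_ge0 => //; exact: psd_one.
Qed.

Lemma tr_rho_ge0 l (M : meas l) j : povm M ->
  0 <= op_tr (op_mul (e_rho (E l) j) (M j)).
Proof. by move=> hM; apply: psd_trM_ge0; [exact: ((vE l).2.2 j).1 | exact: hM.1]. Qed.

Lemma succ_ge0 l (M : meas l) : povm M -> 0 <= @succ R _ (E l) M.
Proof.
move=> hM; apply: sumr_ge0 => j _; apply: mulr_ge0; first exact/ltW/(vE l).1.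
exact/Re_ge0/tr_rho_ge0.
Qed.

Definition tens_meas (M : forall l, meas l) : e_idx (seq_ens E) -> op R (HbL d L) :=
  fun c => tens (fun l => M l (c l)).

(** Traces and sums over outcome tuples factor over the copies; the traces are nonnegative, hence
    real, which lets [Re] pass through the product. *)
Lemma succ_tens (M : forall l, meas l) : (forall l, povm (M l)) ->
  @succ R _ (seq_ens E) (tens_meas M) = \prod_l @succ R _ (E l) (M l).
Proof.
move=> hM; rewrite /succ -sum_dffun_prod; apply: eq_bigr => c _ /=.
rewrite big_split /=; congr (_ * _).
rewrite -[X in op_mul X _]/(tens (fun l => e_rho (E l) (c l))).
rewrite /tens_meas tens_mul tr_tens Re_prod_ge0 // => l.
exact: tr_rho_ge0.
Qed.

Lemma povm_tens (M : forall l, meas l) :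
  (forall l, povm (M l)) -> povm (tens_meas M).
Proof.
move=> hM; split=> [c|x y].
  by apply: psd_tens => l; exact: (hM l).1.
rewrite -tens_one /tens_meas /tens.
rewrite (sum_dffun_prod (fun l j => M l j (copy l x) (copy l y))).
by apply: eq_bigr => l _; exact: (hM l).2.
Qed.

Lemma dominates_tens (K : 'I_L -> op R (Hb d)) :
  (forall l, dominates (E l) (K l)) ->
  dominates (seq_ens E) (tens K).
Proof.
move=> hK c.
have := @psd_tens_sub R m d L (fun l => weighted (c l)) K.
rewrite (_ : tens (fun l => weighted (c l)) = @weighted R _ (seq_ens E) c).
  apply=> l; [exact: psd_weighted | exact: hK].
apply/funeq2P => x y; rewrite /tens /weighted /= big_split /=; congr (_ * _).
by rewrite rmorph_prod.
Qed.

(** [K] is a weighted state plus a positive remainder. Its trace is thus nonnegative, as needed to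
    multiply real parts and bounds. *)
Lemma dominates_psd l K : dominates (E l) K -> psd K.
Proof.
move=> hK; have [j _] := idx_inhabited (vE l).
have := psdD (psd_weighted (vE l) j) (hK j).
by congr psd; apply/funeq2P => x y; rewrite addrC subrK.
Qed.

Lemma succ_le_prod_tr (K : 'I_L -> op R (Hb d)) M :
  (forall l, dominates (E l) (K l)) -> povm M ->
  @succ R _ (seq_ens E) M <= \prod_l complex.Re (op_tr (K l)).
Proof.
move=> hK hM; apply: le_trans (weak_duality (dominates_tens hK) hM) _.
rewrite tr_tens Re_prod_ge0 // => l.
exact/psd_tr_ge0/dominates_psd.
Qed.

Lemma locc_exists l : exists M : meas l, locc M.
Proof.
have [j _] := idx_inhabited (vE l).
by eexists; exact: (locc_stop _ _ j).
Qed.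

(** Always answering [j] without measuring is LOCC and succeeds with probability at least
    [e_eta (E l) j]. *)
Lemma pL_gt0 l : 0 < pL (E l).
Proof.
have [j _] := idx_inhabited (vE l).
set M : meas l := fun i => if i == j then @op_one R _ else (fun _ _ => 0).
have hM : locc M by exact: locc_stop.
apply: (@lt_le_trans _ _ (@succ R _ (E l) M)).
  rewrite /succ (bigD1 j) //= /M eqxx op_mul1 ((vE l).2.2 j).2 mulr1.
  apply: ltr_pwDl; first exact: (vE l).1.
  apply: sumr_ge0 => i _; apply: mulr_ge0; first exact/ltW/(vE l).1.
  exact: Re_ge0 (tr_rho_ge0 i (locc_povm hM)).
apply: ub_le_sup; last by exists M.
exists (pG (E l)) => _ [N [hN ->]]; exact/pG_ub/locc_povm.
Qed.

Lemma pL_le_pG l : pL (E l) <= pG (E l).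
Proof.
apply: ge_sup; first by have [M hM] := locc_exists l; exists (succ M); exists M.
move=> _ [N [hN ->]]; exact/pG_ub/locc_povm.
Qed.

Lemma pG_ge0 l : 0 <= pG (E l).
Proof. exact: le_trans (ltW (pL_gt0 l)) (pL_le_pG l). Qed.

Lemma seq_idx_inhabited : exists c : e_idx (seq_ens E), True.
Proof.
by exists (finfun (fun l => projT1 (cid (idx_inhabited (vE l))))).
Qed.

(** Tensor products of dominating operators bound the success value by products of traces, and
    strong duality brings each trace down to [pG (E l)]. This also bounds the sets whose suprema are
    [pG] and [pL] of the sequence. *)
Lemma succ_seq_le M : povm M -> @succ R _ (seq_ens E) M <= \prod_l pG (E l).
Proof.
move=> hM.
refine (@prod_closure R L (fun l => [set r | exists K,
  dominates (E l) K /\ r = complex.Re (op_tr K)]%classic) (fun l => pG (E l))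
  (fun z => is_true (@succ R _ (seq_ens E) M <= z)) _ _ _ _ _).
- move=> l _ [K [hK ->]].
  exact/Re_ge0/psd_tr_ge0/dominates_psd.
- exact: pG_ge0.
- by move=> l; have [K [hK _]] := strong_duality (vE l) ltr01; eexists; exists K.
- move=> l c c0 h; apply/ler_addgt0Pr => e e0.
  (* With this tolerance the error stays below [e] after multiplication by [c]; the [+ 1] covers
     [c = 0]. *)
  have e1 : 0 < e / (c + 1) by rewrite divr_gt0 // ltr_wpDl.
  have [K [hK Ke]] := strong_duality (vE l) e1.
  apply: (le_trans (h _ (ex_intro _ K (conj hK erefl)))).
  apply: (@le_trans _ _ ((pG (E l) + e / (c + 1)) * c)).
    by rewrite ler_wpM2r // ltW.
  rewrite mulrDl lerD2l mulrAC ler_pdivrMr ?ltr_wpDl //.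
  by rewrite ler_wpM2l ?(ltW e0) // lerDl.
- move=> r hr; have [K hK] := choice hr.
  rewrite (eq_bigr (fun l => complex.Re (op_tr (K l)))).
    by apply: succ_le_prod_tr => // l; exact: (hK l).1.
  by move=> l _; exact: (hK l).2.
Qed.

Lemma pG_seq_ub M : povm M -> @succ R _ (seq_ens E) M <= pG (seq_ens E).
Proof.
move=> hM; apply: ub_le_sup; last by exists M.
by exists (\prod_l pG (E l)) => _ [N [hN ->]]; exact: succ_seq_le.
Qed.

Lemma pL_seq_ub M : locc M -> @succ R _ (seq_ens E) M <= pL (seq_ens E).
Proof.
move=> hM; apply: ub_le_sup; last by exists M.
by exists (\prod_l pG (E l)) => _ [N [hN ->]]; exact/succ_seq_le/locc_povm.
Qed.

Lemma pL_seq_le_pG_seq : pL (seq_ens E) <= pG (seq_ens E).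
Proof.
have [c _] := seq_idx_inhabited.
apply: ge_sup; first by eexists; eexists; split; first exact: (locc_stop _ _ c).
move=> _ [N [hN ->]]; exact/pG_seq_ub/locc_povm.
Qed.

Lemma pG_seq_le : pG (seq_ens E) <= \prod_l pG (E l).
Proof.
have [c _] := seq_idx_inhabited.
apply: ge_sup => [|_ [N [hN ->]]]; last exact: succ_seq_le.
by eexists; eexists; split; first exact: locc_povm (locc_stop _ _ c).
Qed.

(** Supplies the replacement step of [prod_closure] for upper bounds; at [c = 0] division is
    impossible and any element of [S] settles the claim. *)
Lemma mul_sup_le (S : set R) (c u : R) : 0 <= c -> (S !=set0)%classic ->
  (forall r, S r -> r * c <= u) -> sup S * c <= u.
Proof.
move=> c0 [r0 hr0] h; have [c00|cn0] := eqVneq c 0.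
  by have := h _ hr0; rewrite c00 !mulr0.
have cp : 0 < c by rewrite lt_def cn0.
rewrite -ler_pdivlMr //; apply: ge_sup; first by exists r0.
by move=> r hr; rewrite ler_pdivlMr // h.
Qed.

Lemma prod_pG_le : \prod_l pG (E l) <= pG (seq_ens E).
Proof.
refine (@prod_closure R L (fun l => [set r | exists M : meas l,
  povm M /\ r = @succ R _ (E l) M]%classic) (fun l => pG (E l)) (fun z => is_true (z <= _)) _ _ _ _ _).
- by move=> l _ [M [hM ->]]; exact: succ_ge0.
- exact: pG_ge0.
- by move=> l; have [[r hr] _] := pG_has_sup (vE l); exists r.
- by move=> l c c0; apply: mul_sup_le => //; exact: (pG_has_sup (vE l)).1.
- move=> r hr.
  have [M hM] : exists M : forall l, meas l,
     forall l, povm (M l) /\ r l = @succ R _ (E l) (M l).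
    by exists (fun l => projT1 (cid (hr l))) => l; exact: projT2 (cid (hr l)).
  rewrite (eq_bigr (fun l => @succ R _ (E l) (M l))); last first.
    by move=> l _; exact: (hM l).2.
  have hp l : povm (M l) := (hM l).1.
  by rewrite -succ_tens //; apply/pG_seq_ub/povm_tens.
Qed.

Lemma prod_pL_le : \prod_l pL (E l) <= pL (seq_ens E).
Proof.
refine (@prod_closure R L (fun l => [set r | exists M : meas l,
  locc M /\ r = @succ R _ (E l) M]%classic) (fun l => pL (E l)) (fun z => is_true (z <= _)) _ _ _ _ _).
- by move=> l _ [M [hM ->]]; exact/succ_ge0/locc_povm.
- by move=> l; exact/ltW/pL_gt0.
- by move=> l; have [M hM] := locc_exists l; exists (succ M); exists M.
- move=> l c c0; apply: mul_sup_le => //.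
  by have [M hM] := locc_exists l; exists (succ M); exists M.
- move=> r hr.
  have [M hM] : exists M : forall l, meas l,
     forall l, locc (M l) /\ r l = @succ R _ (E l) (M l).
    by exists (fun l => projT1 (cid (hr l))) => l; exact: projT2 (cid (hr l)).
  rewrite (eq_bigr (fun l => @succ R _ (E l) (M l))); last first.
    by move=> l _; exact: (hM l).2.
  have hp l : locc (M l) := (hM l).1.
  rewrite -succ_tens => [|l]; last exact: locc_povm.
  have [c _] := seq_idx_inhabited.
  by apply/pL_seq_ub/(locc_tens c).
Qed.

End Sequence.

(** One strict inequality [a l < b l] would make the products strictly ordered, since the remaining
    factors are positive. *)
Lemma prod_eq_factors (R : realFieldType) (L : nat) (a b : 'I_L -> R) :
  (forall l, 0 < a l) -> (forall l, a l <= b l) ->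
  \prod_l b l <= \prod_l a l -> forall l, a l = b l.
Proof.
move=> a0 ab h l; apply/eqP; rewrite eq_le ab /= leNgt; apply/negP => lt.
move: h; rewrite leNgt => /negP; apply.
rewrite (bigD1 l) //= [ltRHS](bigD1 l) //=.
apply: (@lt_le_trans _ _ (b l * \prod_(i | i != l) a i)).
  by rewrite ltr_pM2r // prodr_gt0.
apply: ler_wpM2l; first exact: le_trans (ltW (a0 l)) (ab l).
by apply: ler_prod => i _; rewrite ab ltW // a0.
Qed.

Theorem theorem3 (R : realType) (m : nat) (d : 'I_m -> nat) (L : nat)
  (E : 'I_L -> ensemble R (Hb d)) :
  (2 <= m)%N -> (forall k, (2 <= d k)%N) -> (1 <= L)%N ->
  (forall l, valid_ensemble (E l)) ->
  ((\prod_(l < L) pL (E l) = pL (seq_ens E) /\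
    pL (seq_ens E) = pG (seq_ens E))
   <-> (forall l, pL (E l) = pG (E l))).
Proof.
move=> _ _ _ vE; split=> [[e1 e2]|h].
  (* The equalities give that the product of the [pG (E l)] is at most [pG (seq_ens E)], which is
     the product of the [pL (E l)]. *)
  apply: prod_eq_factors => [l|l|]; [exact: pL_gt0 | exact: pL_le_pG |].
  by rewrite e1 e2; exact: prod_pG_le.
(* The chain from the product of the [pL (E l)] through [pL] and [pG] of the sequence to the product
   of the [pG (E l)] has equal ends, so it collapses. *)
have pLG := pL_seq_le_pG_seq vE.
have GL : pG (seq_ens E) <= \prod_l pL (E l).
  apply: le_trans (pG_seq_le vE) _.
  by under eq_bigr => l _ do rewrite -h.
have LL := prod_pL_le vE.
split; apply/eqP; rewrite eq_le.
  by rewrite LL (le_trans pLG GL).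
by rewrite pLG (le_trans GL LL).
Qed.
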